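(* Let $K$ be a totally real number field with ring of integers $\mathcal O$, and let $\mathcal O^+$ be the set of totally positive elements of $\mathcal O$. Suppose $\mathfrak p$ is a prime ideal of $\mathcal O$ such that $5\in\mathfrak p$ and $\mathcal O/\mathfrak p\cong\mathbb Z/5\mathbb Z$. Let $\delta\in\mathcal O^+$. 1. The partitions of $\delta$ in which each part is congruent to $1$ or $4$ modulo $\mathfrak p$ are equinumerous with the partitions $\lambda=(\lambda_1,\ldots,\lambda_r)$ of $\delta$ in which (i) the primitive factor of each part is not congruent to $0$ modulo $\mathfrak p$, (ii) the difference between the scales of any two parts in the same section is at least $2$ (i.e. $|s(\lambda_a)-s(\lambda_b)|\ge2$ whenever $a\ne b$ and $t(\lambda_a)=t(\lambda_b)$), (iii) there is no primitive part congruent to $2$ or $3$ modulo $\mathfrak p$. 2. The partitions of $\delta$ in which each part is congruent to $2$ or $3$ modulo $\mathfrak p$ are equinumerous with the partitions $\lambda=(\lambda_1,\ldots,\lambda_r)$ of $\delta$ in which (i) the primitive factor of each part is not congruent to $0$ modulo $\mathfrak p$, (ii) the difference between the scales of any two parts in the same section is at least $2$ (in the same sense as in 1(ii)), (iii) there is no primitive part congruent to $1$ or $4$ modulo $\mathfrak p$.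
   Context: A partition of $\delta\in\mathcal O^+$ is a finite sequence $\lambda=(\lambda_1,\ldots,\lambda_r)$ of elements of $\mathcal O^+$ (the parts) with $\lambda_1+\cdots+\lambda_r=\delta$; partitions are considered (and counted) up to change of order, i.e. as multisets. Each $\delta\in\mathcal O^+$ has only finitely many partitions. An element $\gamma\in\mathcal O^+$ is primitive if $\gamma\notin n\mathcal O^+$ for every rational integer $n\ge 2$. Every $\delta\in\mathcal O^+$ can be written uniquely as $\delta=s(\delta)t(\delta)$ with $s(\delta)\in\mathbb Z^+$ (the scale) and $t(\delta)$ primitive (the primitive factor). Two elements of $\mathcal O^+$ are in the same section if they have the same primitive factor. *)

(* Defs.v *)
From HB Require Import structures.
From mathcomp Require Import all_boot all_order all_algebra all_field.
From mathcomp Require Import generic_quotient ring_quotient finmap multiset.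
From mathcomp Require Import boolp classical_sets functions cardinality.

Set Implicit Arguments.
Unset Strict Implicit.
Unset Printing Implicit Defensive.

Import Order.TTheory GRing.Theory Num.Theory.
Local Open Scope ring_scope.

Section RingOfIntegers.
Variable K : fieldExtType rat.

Definition alg_integer : {pred K} :=
  fun x => `[< integralOver (intr : int -> K) x >].

Fact alg_integer_subring : subring_closed alg_integer.
Proof.
split=> [|x y /asboolP Ix /asboolP Iy|x y /asboolP Ix /asboolP Iy]; apply/asboolP.
- exact: (@integral1 _ _ (intmul 1 : {rmorphism int -> K})).
- exact: (@integral_sub _ _ (intmul 1 : {rmorphism int -> K})).
- exact: (@integral_mul _ _ (intmul 1 : {rmorphism int -> K})).
Qed.

HB.instance Definition _ :=
  GRing.isSubringClosed.Build K alg_integer alg_integer_subring.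

Record ring_of_integers := RingInt {
  int_val :> K;
  _ : int_val \in alg_integer }.

HB.instance Definition _ := [isSub for int_val].
HB.instance Definition _ := [Choice of ring_of_integers by <:].
HB.instance Definition _ :=
  [SubChoice_isSubComNzRing of ring_of_integers by <:].

End RingOfIntegers.

Section Partitions.
Variable K : fieldExtType rat.
Local Notation O := (ring_of_integers K).

(* Every embedding of a number field into the complex numbers takes values in
   the algebraic numbers, so algC is a sufficient codomain. *)
Definition totally_real : Prop :=
  forall (sigma : {rmorphism K -> algC}) (x : K), sigma x \is Num.real.

Definition Oplus : set O :=
  [set x | forall sigma : {rmorphism K -> algC}, 0 < sigma (\val x)].

Definition primitive (g : O) : Prop :=
  Oplus g /\
  forall n : nat, (2 <= n)%N -> ~ exists2 b : O, Oplus b & g = b *+ n.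

Definition scale_factorization (x : O) : set (nat * O) :=
  [set st | [/\ (0 < st.1)%N, primitive st.2 & x = st.2 *+ st.1]].

(* The default value (0, 0) is only taken outside Oplus: see
   [scale_factorization_exists] and [scale_factorization_uniq] below. *)
Definition scale (x : O) : nat :=
  (xget (0%N, 0) (scale_factorization x)).1.

Definition primitive_factor (x : O) : O :=
  (xget (0%N, 0) (scale_factorization x)).2.

Definition is_partition (d : O) (l : {mset O}%mset) : Prop :=
  (forall x, x \in l -> Oplus x) /\ \sum_(x <- l) x = d.

(* Quantifying over positions in the enumeration of the multiset, rather than
   over elements, makes the condition apply to two equal parts as well. *)
Definition scale_gap2 (l : {mset O}%mset) : Prop :=
  forall a b : nat, (a < size l)%N -> (b < size l)%N -> a != b ->
    let x := nth 0 l a in let y := nth 0 l b in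
    primitive_factor x = primitive_factor y -> (2 <= `|scale x - scale y|)%N.

End Partitions.

Section ScaleFactorization.
Variable K : fieldExtType rat.
Local Notation O := (ring_of_integers K).

Lemma number_field_mulrn_eq0 (x : K) n : (x *+ n == 0) = (n == 0%N) || (x == 0).
Proof.
have nz m : (m.+1%:R : K) != 0.
  by rewrite -(rmorph_nat (GRing.in_alg K)) fmorph_eq0 pnatr_eq0.
by rewrite -mulr_natr mulf_eq0 orbC; case: n => [|n]; rewrite ?eqxx ?(negPf (nz n)).
Qed.

Lemma embedding_exists : exists sigma : {rmorphism K -> algC}, True.
Proof.
have char0 : has_pchar0 K.
  move=> q; rewrite !inE; apply/negP => /andP[q_pr].
  by rewrite -(mulr1n 1) -mulrnA mul1n number_field_mulrn_eq0 oner_eq0 orbF;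
     case: q q_pr.
have sepK : separable 1%AS {:K}%AS.
  by apply/separableP => y _; apply: pcharf0_separable.
have := eq_adjoin_separable_generator sepK (sub1v _).
set z := separable_generator _ _ => Dz.
have xq (x : K) : {q : {poly rat} | (map_poly (GRing.in_alg K) q).[z] = x}.
  apply: cid; have Kx : x \in <<1; z>>%VS by rewrite -Dz memvf.
  have /polyOver1P[q Dq] := Fadjoin_polyOver 1%AS z x.
  by exists q; rewrite -Dq Fadjoin_poly_eq.
have /polyOver1P[m Dm] := minPolyOver 1%AS z.
have mz : root (map_poly (GRing.in_alg K) m) z by rewrite -Dm root_minPoly.
have [w mw] : exists w : algC, root (map_poly ratr m) w.
  apply/closed_rootP; rewrite size_map_poly -(size_map_poly (GRing.in_alg K)).
  by rewrite -Dm size_minPoly.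
pose s x := (map_poly ratr (sval (xq x))).[w] : algC.
have sE x q : (map_poly (GRing.in_alg K) q).[z] = x -> s x = (map_poly ratr q).[w].
  move=> qx; apply/eqP; rewrite -subr_eq0 -hornerN -hornerD -rmorphB /=.
  have : m %| (sval (xq x) - q).
    rewrite -(dvdp_map (GRing.in_alg K)) -Dm minPoly_dvdp //.
      by apply/polyOver1P; eexists.
    by rewrite rmorphB rootE hornerD hornerN qx (svalP (xq x)) subrr.
  by case/dvdpP => r ->; rewrite rmorphM hornerM (rootP mw) mulr0.
have sB : zmod_morphism s.
  move=> x y; rewrite (sE _ (sval (xq x) - sval (xq y))).
    by rewrite rmorphB hornerD hornerN.
  by rewrite rmorphB hornerD hornerN (svalP (xq x)) (svalP (xq y)).
have sM : monoid_morphism s.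
  split=> [|x y]; first by rewrite (sE _ 1) rmorph1 hornerC.
  rewrite (sE _ (sval (xq x) * sval (xq y))) rmorphM hornerM //.
  by rewrite (svalP (xq x)) (svalP (xq y)).
pose sZ := GRing.isZmodMorphism.Build _ _ s sB.
pose sR := GRing.isMonoidMorphism.Build _ _ s sM.
by exists (HB.pack_for {rmorphism K -> algC} s sZ sR).
Qed.

Lemma Oplus_neq0 (x : O) : Oplus x -> \val x != 0.
Proof.
have [sigma _] := embedding_exists => /(_ sigma).
by apply: contraTneq => ->; rewrite rmorph0 ltxx.
Qed.

Lemma OplusMn (x : O) n : (0 < n)%N -> Oplus (x *+ n) <-> Oplus x.
Proof.
move=> n0; have vMn : \val (x *+ n) = \val x *+ n by exact: raddfMn.
by split=> + sigma => /(_ sigma); rewrite vMn raddfMn pmulrn_lgt0.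
Qed.

Lemma ring_of_integers_mulrnI n : (0 < n)%N -> injective (fun x : O => x *+ n).
Proof.
move=> n0 x y /(congr1 val) /eqP; rewrite !raddfMn -subr_eq0 -mulrnBl /=.
by rewrite number_field_mulrn_eq0 eqn0Ngt n0 /= subr_eq0 => /eqP/val_inj.
Qed.

Lemma primitive_mulrn_dvd (t1 t2 : O) s1 s2 :
  (0 < s1)%N -> (0 < s2)%N -> primitive t1 -> t1 *+ s1 = t2 *+ s2 ->
  (s2 %| s1)%N.
Proof.
move=> s1_0 s2_0 [t1_pos t1_prim] e12.
have [g0 gs1 gs2] : [/\ (0 < gcdn s1 s2)%N, (gcdn s1 s2 %| s1)%N
                       & (gcdn s1 s2 %| s2)%N].
  by rewrite gcdn_gt0 s1_0 dvdn_gcdl dvdn_gcdr.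
case: (egcdnP s2 s1_0) => a b Dab _.
have Dg : t1 *+ gcdn s1 s2 = (t2 *+ a - t1 *+ b) *+ s2.
  rewrite mulrnBl -!mulrnA (mulnC a) mulrnA -e12 -mulrnA (mulnC s1) Dab.
  by rewrite mulrnDr addrC addKr.
have /dvdnP[k Dk] := gs2.
have k0 : (0 < k)%N by move: s2_0; rewrite Dk muln_gt0 => /andP[].
have Dt : t1 = (t2 *+ a - t1 *+ b) *+ k.
  by apply: (ring_of_integers_mulrnI g0); rewrite /= Dg {1}Dk mulrnA.
case: (leqP 2 k) => [k2|]; last first.
  by case: k k0 Dk {Dt} => [|[|]] // _; rewrite mul1n => ->.
have [] := t1_prim _ k2; exists (t2 *+ a - t1 *+ b) => //.
by apply/(OplusMn _ k0); rewrite -Dt.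
Qed.

Lemma scale_factorization_uniq (x : O) : is_subset1 (scale_factorization x).
Proof.
move=> [s1 t1] [s2 t2] [/= s1_0 t1P ->] [/= s2_0 t2P e12].
suff Ds : s1 = s2.
  by rewrite -Ds in e12 *; rewrite (ring_of_integers_mulrnI s1_0 e12).
apply/eqP; rewrite eqn_dvd.
by rewrite (primitive_mulrn_dvd _ _ t1P e12) // (primitive_mulrn_dvd _ _ t2P (esym e12)).
Qed.

Lemma mulrn_divisor_bounded (x : O) : \val x != 0 ->
  exists N, forall n (y : O), x = y *+ n -> (n <= N)%N.
Proof.
move=> x0; have /asboolP[P Pmon Px] : \val x \in @alg_integer K := valP x.
have P0 : P != 0 by apply: monic_neq0.
have [m [Q]] := multiplicity_XsubC P 0; rewrite P0 /= subr0 => Q0 DP.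
have Qx : root (map_poly intr Q) (\val x).
  move: Px; rewrite DP rmorphM rootM rmorphXn /= map_polyX.
  by rewrite [X in _ || X]rootE hornerXn expf_eq0 (negPf x0) andbF orbF.
set c := Q.[0] in Q0; exists `|c|%N => n y Dx.
have c0 : c != 0 by [].
have n0 : (0 < n)%N.
  by case: n Dx => // Dx; move: x0; rewrite Dx mulr0n raddf0 eqxx.
(* Q = c + 'X * R, hence c = - x * R(x) = - n * y * R(x) *)
have [R DQ] : exists R, Q = R * 'X + c%:P.
  have /factor_theorem[R DR] : root (Q - c%:P) 0.
    by rewrite rootE hornerD hornerN hornerC subrr.
  by exists R; rewrite -[LHS](subrK c%:P) DR subr0.
pose u : K := - (\val y) * (map_poly intr R).[val x].
have Du : u *+ n = c%:~R.
  move/rootP: Qx; rewrite DQ rmorphD rmorphM /= map_polyX map_polyC /=.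
  rewrite hornerD hornerC hornerM hornerX => /eqP; rewrite addrC addr_eq0 => /eqP ->.
  rewrite /u; move: (_.[_]) => r; have -> : val x = val y *+ n by rewrite Dx raddfMn.
  by rewrite mulNr mulNrn mulrC mulrnAr.
have Iu : u \in @alg_integer K.
  rewrite rpredM ?rpredN ?(valP y) // horner_coef rpred_sum // => i _.
  by rewrite rpredM ?rpredX ?(valP x) // coef_map rpred_int.
have [sigma _] := embedding_exists.
have nC : n%:R != 0 :> algC by rewrite pnatr_eq0 -lt0n.
have Dsu : sigma u = c%:~R / n%:R.
  by apply: (mulIf nC); rewrite divfK // mulr_natr -raddfMn Du; exact: (rmorph_int sigma).
have /intrP[k Dk] : sigma u \is a Num.int.
  apply: Cint_rat_Aint; first by rewrite Dsu rpred_div ?rpred_int ?rpred_nat.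
  have /asboolP[T Tmon Tu] := Iu.
  apply: (@root_monic_Aint (map_poly intr T)); last 2 first.
  - exact: monic_map Tmon.
  - by apply/polyOverP => i; rewrite coef_map /= rpred_int.
  have := Tu; rewrite -(fmorph_root sigma) -map_poly_comp.
  by congr root; apply: eq_map_poly => i /=; rewrite rmorph_int.
have Dc : c = k * n%:Z.
  apply: (@intr_inj algC); rewrite rmorphM /= -Dk Dsu.
  by rewrite -[n%:~R]/(n%:R) divfK.
by rewrite Dc abszM absz_nat leq_pmull // absz_gt0; apply: contraNneq c0 => k0;
   rewrite Dc k0 mul0r.
Qed.

Lemma scale_factorization_exists (x : O) :
  Oplus x -> scale_factorization x (scale x, primitive_factor x).
Proof.
move=> x_pos; have [N NP] := mulrn_divisor_bounded (Oplus_neq0 x_pos).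
suff: exists st, scale_factorization x st.
  by move/(xgetPex (0%N, 0)); rewrite /scale /primitive_factor; case: xget.
pose P n := `[< exists2 y : O, Oplus y & x = y *+ n >].
have exP : exists n, P n by exists 1%N; apply/asboolP; exists x.
have ubP n : P n -> (n <= N)%N by move=> /asboolP[y _]; apply: NP.
case: (ex_maxnP exP ubP) => s /asboolP[t t_pos Dx] s_max.
have s0 : (0 < s)%N.
  case: s Dx {s_max} => // Dx; have := Oplus_neq0 x_pos.
  by rewrite Dx mulr0n raddf0 eqxx.
exists (s, t); split=> //=; split=> // n n2 [b b_pos Dt].
have /s_max : P (n * s)%N by apply/asboolP; exists b => //; rewrite mulrnA -Dt.
by rewrite leqNgt ltn_Pmull.
Qed.

End ScaleFactorization.

(* Main.v *)
(** Writing a part as [x = t *+ k] with [t] primitive splits a partition of [d]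
    into one ordinary partition for each section [t], and both sides of each
    identity are conditions on these ordinary partitions.  Through
    [O / p = Z / 5], the condition on the section of [t] allows no part if
    [t = 0 mod p], and is otherwise one of the two Rogers-Ramanujan conditions,
    according to the class of [t] up to sign.  Hence the theorem is the
    Rogers-Ramanujan identities applied section by section.

    The latter are proved by Schur's method.  The generating polynomials of
    the gap partitions with largest part at most [n] satisfy
    [D_n = D_(n-1) + q^n D_(n-2)], which is also satisfied by a bilateral
    alternating sum of Gaussian binomials.  Modulo a power of [q], for [n]
    large, multiplying this sum by [prod (1 - q^i)] gives a theta series, which
    is a product by a finite form of Jacobi's triple product identity. *)
Require Import Defs.
From HB Require Import structures.
From mathcomp Require Import all_boot all_order all_algebra all_field.
From mathcomp Require Import generic_quotient ring_quotient finmap multiset.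
From mathcomp Require Import boolp classical_sets functions cardinality.
From mathcomp Require Import qpoly zify ring.

Set Implicit Arguments.
Unset Strict Implicit.
Unset Printing Implicit Defensive.

Import Order.TTheory GRing.Theory Num.Theory.
Local Open Scope ring_scope.

(** * Gaussian binomials *)

Section GaussianBinomials.
Variables (R : comNzRingType) (q : R).

Fixpoint qbin (n k : nat) : R :=
  match n, k with
  | _, 0%N => 1
  | 0%N, _.+1 => 0
  | n'.+1, k'.+1 => qbin n' k' + q ^+ k'.+1 * qbin n' k'.+1
  end.

Lemma qbin0 n : qbin n 0 = 1. Proof. by case: n. Qed.

Lemma qbin_small n k : (n < k)%N -> qbin n k = 0.
Proof.
elim: n k => [|n IHn] [|k] //= lt_nk.
by rewrite !IHn ?mulr0 ?addr0 // ltnW.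
Qed.

Lemma qbinS n k :
  qbin n.+1 k.+1 = qbin n k + q ^+ k.+1 * qbin n k.+1.
Proof. by []. Qed.

(** The mirror q-Pascal rule. Schur's recurrence uses both rules, in an order that depends on a
    parity. *)
Lemma qbinSr n k : (k <= n)%N ->
  qbin n.+1 k.+1 = q ^+ (n - k) * qbin n k + qbin n k.+1.
Proof.
elim: n k => [|n IHn] [|k] // le_kn.
- by rewrite /= expr0 !mulr0 !addr0 mulr1.
- rewrite qbinS [in LHS]IHn // !subn0 [qbin n.+1 1]qbinS !qbin0 (exprS _ n) expr1; ring.
- rewrite qbinS [in LHS](IHn k) // subSS.
  have -> : q ^+ k.+2 * qbin n.+1 k.+2
          = q ^+ (n - k) * q ^+ k.+1 * qbin n k.+1 + q ^+ k.+2 * qbin n k.+2.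
    case: (ltnP k n) => [lt_kn|le_nk].
      rewrite IHn // mulrDr !mulrA -!exprD.
      by congr (q ^+ _ * _ + _); lia.
    by rewrite !qbin_small ?mulr0 ?addr0 //; lia.
  rewrite !qbinS; ring.
Qed.

Definition qpoch n : R := \prod_(i < n) (1 - q ^+ i.+1).

Lemma qpochS n : qpoch n.+1 = qpoch n * (1 - q ^+ n.+1).
Proof. by rewrite /qpoch big_ord_recr. Qed.

(** The quotient formula without division, usable when [q] is nilpotent. *)
Lemma qbin_qpoch n k : (k <= n)%N ->
  qbin n k * (qpoch k * qpoch (n - k)) = qpoch n.
Proof.
elim: n k => [|n IHn] [|k] le_kn //.
- by rewrite qbin0 /qpoch big_ord0 !mulr1.
- by rewrite qbin0 /qpoch big_ord0 !mul1r.
- rewrite qbinS subSS qpochS mulrDl.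
  have -> : qbin n k * (qpoch k * (1 - q ^+ k.+1) * qpoch (n - k))
          = (1 - q ^+ k.+1) * qpoch n by rewrite -(IHn k) //; ring.
  have -> : q ^+ k.+1 * qbin n k.+1 * (qpoch k * (1 - q ^+ k.+1) * qpoch (n - k))
          = q ^+ k.+1 * (1 - q ^+ (n - k)) * qpoch n.
    case: (ltnP k n) => [lt_kn|le_nk].
      have -> : (n - k = (n - k.+1).+1)%N by lia.
      by rewrite -(IHn k.+1) // !qpochS; ring.
    have -> : (n - k = 0)%N by lia.
    by rewrite qbin_small // expr0 subrr !mulr0 !mul0r.
  rewrite qpochS; have -> : q ^+ n.+1 = q ^+ k.+1 * q ^+ (n - k).
    by rewrite -exprD; congr (_ ^+ _); lia.
  ring.
Qed.

(** Peel off the factor [k = 0] and apply the induction hypothesis to [b * q]; the two sums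
    recombine by q-Pascal. The homogeneous form lets [a] be a power of [q] later on, without
    negative exponents. *)
Lemma qbinomial (a b : R) n :
  \prod_(k < n) (a + b * q ^+ k) =
  \sum_(j < n.+1) q ^+ 'C(j, 2) * qbin n j * b ^+ j * a ^+ (n - j).
Proof.
elim: n b => [|n IHn] b.
  by rewrite big_ord0 big_ord_recr big_ord0 /= !mulr1 add0r.
rewrite big_ord_recl expr0 mulr1.
under eq_bigr => i _ do rewrite /bump /= exprS mulrA.
rewrite IHn mulrDl [X in X + _]big_distrr [X in _ + X]big_distrr /=.
rewrite big_ord_recl [RHS]big_ord_recl /= qbin0 !subn0 !expr0 !mulr1 !mul1r.
rewrite -exprS -addrA; congr (_ + _).
rewrite [X in _ + X](eq_bigr (fun j : 'I_n.+1 =>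
  q ^+ 'C(j.+1, 2) * qbin n j * b ^+ j.+1 * a ^+ (n - j))); last first.
  move=> j _; rewrite binS bin1 exprMn exprD [b ^+ _.+1]exprS; ring.
(* The added term [i = n] is 0 because [qbin q n n.+1] is; both sums then have the same range. *)
have -> : \sum_(i < n) a * (q ^+ 'C(bump 0 i, 2) * qbin n (bump 0 i) *
    (b * q) ^+ bump 0 i * a ^+ (n - bump 0 i))
  = \sum_(i < n.+1) q ^+ 'C(i.+1, 2) * (q ^+ i.+1 * qbin n i.+1) *
     b ^+ i.+1 * a ^+ (n - i).
  rewrite [RHS]big_ord_recr /= (qbin_small (ltnSn n)) !(mulr0, mul0r) addr0.
  apply: eq_bigr => i _; rewrite /bump /= add1n.
  have -> : (n - i = (n - i.+1).+1)%N by have := ltn_ord i; lia.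
  rewrite [a ^+ _.+1]exprS exprMn; ring.
rewrite -big_split; apply: eq_bigr => i _ /=.
rewrite /bump /= add1n subSS; ring.
Qed.

End GaussianBinomials.

(** * Schur's polynomials *)

(* The exponent j (5 j + 1 + 2 c) / 2; throughout, c = 0 and c = 1 stand for the
   first and the second Rogers-Ramanujan identity. *)
Definition theta_exp (c : nat) (j : int) : nat :=
  `|((j * (5 * j + (1 + 2 * c)%N%:Z)) %/ 2)%Z|%N.

(** The halving and the absolute value in [theta_exp] lose nothing: [j] and [5 * j + 1 + 2 * c] have
    opposite parities, and their product is nonnegative for [c <= 1]. *)
Lemma theta_expE c j : (c <= 1)%N ->
  (theta_exp c j)%:Z * 2 = j * (5 * j + (1 + 2 * c)%N%:Z).
Proof.
move=> c1; rewrite /theta_exp; set m := j * _.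
have m2 : (m %% 2)%Z = 0.
  have [i [Dj|Dj]] : exists i : int, j = 2 * i \/ j = 2 * i + 1.
    by exists (j %/ 2)%Z; lia.
    have -> : m = (i * (10 * i + (1 + 2 * c)%N%:Z)) * 2 by rewrite /m Dj; ring.
    by rewrite modzMl.
  have -> : m = (10 * i * i + 11 * i + 3 + c%:Z * (2 * i + 1)) * 2.
    by rewrite /m Dj PoszD PoszM; ring.
  by rewrite modzMl.
have m0 : 0 <= m by rewrite /m; case: c c1 {m m2} => [|[]] // _; nia.
by lia.
Qed.

Lemma theta_expS c j : (c <= 1)%N ->
  (theta_exp c (j + 1))%:Z = (theta_exp c j)%:Z + (5 * j + 3 + c%:Z).
Proof.
move=> c1; have := theta_expE j c1; have := theta_expE (j + 1) c1.
have -> : (j + 1) * (5 * (j + 1) + (1 + 2 * c)%N%:Z)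
  = j * (5 * j + (1 + 2 * c)%N%:Z) + (5 * j + 3 + c%:Z) * 2.
  by rewrite PoszD PoszM; ring.
by move: (j * _) => m; lia.
Qed.

(** Modulo [q ^+ M], this leaves only terms with [|j| < M] in the theta series. *)
Lemma theta_exp_ge c j : (c <= 1)%N -> (`|j| <= theta_exp c j)%N.
Proof.
move=> c1; have := theta_expE j c1.
by case: c c1 => [|[]] // _ /=; nia.
Qed.

Section Bilateral.
Variable R : comNzRingType.

Definition bisum (B : nat) (F : int -> R) : R :=
  \sum_(0 <= i < (2 * B).+1) F (i%:Z - B%:Z).

Lemma eq_bisum B F G : (forall j, (`|j| <= B)%N -> F j = G j) ->
  bisum B F = bisum B G.
Proof. by move=> eqFG; apply: eq_big_nat => i /andP[_ lt_i]; apply: eqFG; lia. Qed.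

Lemma bisum_tele B (G : int -> R) :
  bisum B (fun j => G j - G (j + 1)) = G (- B%:Z) - G (B.+1)%:Z.
Proof.
rewrite /bisum (telescope_sumr_eq (fun i : nat => - G (i%:Z - B%:Z))) //.
  by rewrite opprK addrC sub0r; congr (G _ - G _); lia.
move=> i _; rewrite opprK addrC; congr (- G _ + G _); lia.
Qed.

Lemma bisum_1 B F : (forall j, j != 0 -> F j = 0) -> bisum B F = F 0.
Proof.
move=> F0; rewrite /bisum (@big_cat_nat _ _ _ B) /=; try lia.
rewrite big1_seq ?add0r; last first.
  by move=> i; rewrite mem_index_iota => /andP[_ lt_iB]; apply: F0; lia.
rewrite big_nat_recl; last lia.
rewrite subrr big1_seq ?addr0 // => i; rewrite mem_index_iota => /andP[_ lt_iB].
by apply: F0; lia.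
Qed.

End Bilateral.

Section Schur.
Variables (R : comNzRingType) (q : R) (c : nat).
Hypothesis c1 : (c <= 1)%N.

(** With the value 0 at negative lower indices, both q-Pascal rules hold for every integer [k]: an
    absolute value in an exponent matters only where the binomial it multiplies vanishes. *)
Definition qbz n (k : int) : R := if k is Posz k' then qbin q n k' else 0.

Lemma qbz_out n k : ~~ (0 <= k <= n%:Z) -> qbz n k = 0.
Proof. by case: k => //= k; rewrite lez_nat -ltnNge; apply: qbin_small. Qed.

Lemma qbzS n k : qbz n.+1 k = qbz n (k - 1) + q ^+ `|k| * qbz n k.
Proof.
case: k => [[|k]|k]; first by rewrite /= !qbin0 expr0 mulr1 add0r.
  by have -> : k.+1%:Z - 1 = k by lia.
by rewrite /= mulr0 addr0.
Qed.

Lemma qbzSr n k :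
  qbz n.+1 k = q ^+ `|n.+1%:Z - k| * qbz n (k - 1) + qbz n k.
Proof.
case: k => [[|k]|k]; first by rewrite /= !qbin0 mulr0 add0r.
  have -> : k.+1%:Z - 1 = k by lia.
  case: (leqP k n) => [le_kn|lt_nk].
    have -> : `|n.+1%:Z - k.+1%:Z|%N = (n - k)%N by lia.
    by rewrite /qbz -qbinSr.
  by rewrite /qbz !qbin_small ?mulr0 ?addr0 // ltnW.
by rewrite /= mulr0 addr0.
Qed.

Lemma qbz_expE n k a b : (0 <= k <= n%:Z -> a = b) ->
  q ^+ a * qbz n k = q ^+ b * qbz n k.
Proof.
case: (boolP (0 <= k <= n%:Z)) => [_ -> //|/qbz_out -> _].
by rewrite !mulr0.
Qed.

Definition schur_idx n j : int := ((n%:Z - c%:Z - 5 * j) %/ 2)%Z.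

Definition schur_term n j : R :=
  (-1) ^+ `|j| * q ^+ theta_exp c j * qbz n (schur_idx n j).

Definition schur B n : R := bisum B (schur_term n).

Lemma signr_absz_succ (j : int) : (-1) ^+ `|(j + 1)%R| = - (-1) ^+ `|j| :> R.
Proof.
rewrite -signr_odd -[in RHS]signr_odd.
have -> : odd `|(j + 1)%R|%N = ~~ odd `|j|%N by lia.
by rewrite signrN.
Qed.

(* The q-Pascal rules telescope: schur_term n.+2 j - schur_term n.+1 j -
   q ^+ n.+1 * schur_term n j is G n j or - G n (j + 1), according to the parity
   of n - c - 5 j, and the other one of these two is 0. *)
Let G n j : R := if (2 %| n%:Z - c%:Z - 5 * j)%Z then
  (-1) ^+ `|j| * q ^+ theta_exp c j *
     (q ^+ `|schur_idx n.+2 j| * qbz n (schur_idx n.+2 j)) else 0.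

Lemma schur_term_rec n j :
  schur_term n.+2 j = schur_term n.+1 j + q ^+ n.+1 * schur_term n j
    + (G n j - G n (j + 1)).
Proof.
rewrite /schur_term /G signr_absz_succ.
have [k [Dk|Dk]] : exists k : int, n.+2%:Z - c%:Z - 5 * j = k * 2 \/
                           n.+2%:Z - c%:Z - 5 * j = k * 2 + 1.
- by exists (schur_idx n.+2 j); rewrite /schur_idx; lia.
- have -> : schur_idx n.+2 j = k by rewrite /schur_idx; lia.
  have -> : schur_idx n.+1 j = k - 1 by rewrite /schur_idx; lia.
  have -> : schur_idx n j = k - 1 by rewrite /schur_idx; lia.
  have -> : (2 %| n%:Z - c%:Z - 5 * j)%Z by lia.
  have /negPf -> : ~~ (2 %| n%:Z - c%:Z - 5 * (j + 1))%Z by lia.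
  (* The exponents [k] and [n.+1 - k] of the two rules add up to [n.+1]; the term left over is
     [G n j]. *)
  rewrite qbzS qbzSr [X in _ * (_ + _ * X)]qbzSr !mulrDr.
  have := @qbz_expE n (k - 1) (`|k| + `|(n.+1%:Z - k)%R|)%N n.+1 ltac:(lia).
  rewrite exprD -mulrA => ->; ring.
- have -> : schur_idx n.+2 j = k by rewrite /schur_idx; lia.
  have -> : schur_idx n.+1 j = k by rewrite /schur_idx; lia.
  have -> : schur_idx n j = k - 1 by rewrite /schur_idx; lia.
  have -> : schur_idx n.+2 (j + 1) = k - 1 - 1 by rewrite /schur_idx; lia.
  have /negPf -> : ~~ (2 %| n%:Z - c%:Z - 5 * j)%Z by lia.
  have -> : (2 %| n%:Z - c%:Z - 5 * (j + 1))%Z by lia.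
  rewrite (qbzSr n.+1) (qbzS n (k - 1)) !mulrDr.
  have := @qbz_expE n (k - 1) (`|(n.+2%:Z - k)%R| + `|k - 1|)%N n.+1 ltac:(lia).
  rewrite exprD -mulrA => ->.
  (* The term left over is [- G n (j + 1)]: the two powers of [q] agree by [theta_expS]. *)
  have := @qbz_expE n (k - 1 - 1) (theta_exp c j + `|(n.+2%:Z - k)%R|)%N
            (theta_exp c (j + 1) + `|(k - 1 - 1)%R|)%N.
  rewrite !exprD -!mulrA => ->; last first.
    have De := theta_expS j c1; move=> /andP[k0 kn].
    have: (theta_exp c j)%:Z + (n.+2%:Z - k) = (theta_exp c (j + 1))%:Z + (k - 1 - 1).
      by rewrite De; lia.
    by clear Dk De; lia.
  ring.
Qed.

Lemma schur_rec B n : (n.+2 <= B)%N ->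
  schur B n.+2 = schur B n.+1 + q ^+ n.+1 * schur B n.
Proof.
move=> le_nB; rewrite /schur (eq_bisum (fun j _ => schur_term_rec n j)).
rewrite /bisum 2!big_split /= -big_distrr /= -[RHS]addr0; congr (_ + _).
have := @bisum_tele R B (G n); rewrite /bisum => ->.
(* Telescoping leaves [G n] at [- B] and [B.+1], where the lower index falls outside the range from
   0 to [n]. *)
have qbz0 j : (`|j| >= B)%N -> G n j = 0.
  move=> leBj; rewrite /G qbz_out ?mulr0 ?if_same //.
  by rewrite /schur_idx; lia.
by rewrite !qbz0 ?subrr //; lia.
Qed.

Lemma schur0 B : schur B 0 = (c == 0)%N%:R.
Proof.
rewrite /schur bisum_1 => [|j j0]; last first.
  by rewrite /schur_term qbz_out ?mulr0 // /schur_idx; lia.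
rewrite /schur_term /schur_idx; case: c c1 => [|[]] // _.
  by rewrite /= ?expr0 !mul1r.
by rewrite /= mulr0.
Qed.

Lemma schur1 B : schur B 1 = 1.
Proof.
rewrite /schur bisum_1 => [|j j0]; last first.
  by rewrite /schur_term qbz_out ?mulr0 // /schur_idx; lia.
by rewrite /schur_term /schur_idx; case: c c1 => [|[]] // _; rewrite /= ?expr0 !mul1r.
Qed.

End Schur.

(** * The product side *)

(** Over a domain a nonzero monomial can be cancelled; rings where [q] is nilpotent are reached from
    [{poly rat}] by a morphism. *)
Lemma finite_jacobi_triple_product (R : idomainType) (q : R) (c n : nat) :
  q != 0 -> (c <= 1)%N ->
  \prod_(k < n) ((1 - q ^+ (5 * k + (3 + c))) * (1 - q ^+ (5 * k + (2 - c)))) =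
  bisum n (fun j => (-1) ^+ `|j| * q ^+ theta_exp c j * qbz (q ^+ 5) (2 * n) (n%:Z - j)).
Proof.
move=> q0 c1; set P := \prod_(k < n) _.
(* The q-binomial theorem in base q ^+ 5 for prod_(k < 2 n) (q ^+ a - q ^+ (5 k)):
   the factors with k < n and those with n <= k give the two halves of P. *)
set a := (5 * n - (2 - c))%N.
(* This monomial collects [- q ^+ (5 * k)] from each of the first [n] factors and [q ^+ a] from each
   of the last [n]. *)
have u0 : (-1) ^+ n * q ^+ (5 * 'C(n, 2) + a * n) != 0.
  by rewrite mulf_neq0 ?signr_eq0 ?expf_neq0.
apply: (mulfI u0).
transitivity (\prod_(k < 2 * n) (q ^+ a + (-1) * (q ^+ 5) ^+ k)).
  have -> : (2 * n = n + n)%N by lia.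
  rewrite big_split_ord /= /P big_split /= (reindex_inj rev_ord_inj) /=.
  rewrite [X in _ = X * _](eq_bigr (fun k : 'I_n => (-1) * q ^+ (5 * k) *
      (1 - q ^+ (5 * (n - k.+1) + (3 + c))))); last first.
    move=> k _; have -> : q ^+ a = q ^+ (5 * k) * q ^+ (5 * (n - k.+1) + (3 + c)).
      by rewrite -exprD; congr (_ ^+ _); have := ltn_ord k; rewrite /a; lia.
    by rewrite -exprM; ring.
  rewrite [X in _ = _ * X](eq_bigr (fun k : 'I_n => q ^+ a *
      (1 - q ^+ (5 * k + (2 - c))))); last first.
    move=> k _; rewrite -exprM mulrBr mulr1 mulN1r -exprD.
    by congr (_ - _ ^+ _); have := ltn_ord k; rewrite /a; lia.
  rewrite !big_split /= !prodr_const !card_ord.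
  have -> : \prod_(k < n) q ^+ (5 * k) = q ^+ (5 * 'C(n, 2)).
    rewrite -(big_mkord xpredT (fun k => q ^+ (5 * k))).
    elim: n {P a u0} => [|n IHn]; first by rewrite big_nil.
    by rewrite big_nat_recr //= IHn -exprD binS bin1; congr (_ ^+ _); lia.
  rewrite exprD (exprM q a); ring.
rewrite qbinomial /bisum big_nat_rev big_distrr big_mkord /=.
apply: eq_bigr => -[j /= lt_j] _; set i : int := (_ - _).
have Di : i = n%:Z - j%:Z by rewrite /i; lia.
have -> : n%:Z - i = j by rewrite Di; lia.
have -> : (-1) ^+ j = (-1) ^+ n * (-1) ^+ `|i| :> R.
  rewrite -exprD -signr_odd -[in RHS]signr_odd; congr ((-1) ^+ nat_of_bool _).
  by rewrite Di; lia.
have De : (5 * 'C(j, 2) + a * (2 * n - j) = 5 * 'C(n, 2) + a * n + theta_exp c i)%N.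
  have Hb m : ('C(m, 2) * 2)%N%:Z = m%:Z * m%:Z - m%:Z.
    by elim: m => // m IHm; rewrite binS bin1; lia.
  have := theta_expE i c1; have := Hb j; have := Hb n.
  (* At [n = 0] the natural subtraction in [a] truncates, so this case is treated apart. *)
  have Da : n = 0%N \/ a%:Z = 5 * n%:Z - 2 + c%:Z by rewrite /a; lia.
  case: Da => Da.
    have -> : i = 0 by rewrite Di; lia.
    have -> : j = 0%N by lia.
    have -> : theta_exp c 0 = 0%N by rewrite /theta_exp mul0r.
    by rewrite Da; lia.
  set s := (2 * n - j)%N; have Ds : s%:Z = 2 * n%:Z - j%:Z by rewrite /s; lia.
  rewrite Di => Hn Hj He.
  suff: (5 * 'C(j, 2) + a * s)%N%:Z * 2
     = (5 * 'C(n, 2) + a * n + theta_exp c (n%:Z - j%:Z)%R)%N%:Z * 2 by lia.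
  rewrite !PoszD !PoszM Da Ds !mulrDl He.
  rewrite !PoszM in Hn Hj; rewrite -!mulrA Hn Hj PoszD PoszM; ring.
transitivity ((-1) ^+ n * ((-1) ^+ `|i| * (qbin (q ^+ 5) (2 * n) j *
    q ^+ (5 * 'C(j, 2) + a * (2 * n - j))))).
  by rewrite exprD -!exprM; ring.
by rewrite De exprD [qbz _ _ _]/=; ring.
Qed.

Lemma rmorph_qbin (R S : comNzRingType) (phi : {rmorphism R -> S}) q n k :
  phi (qbin q n k) = qbin (phi q) n k.
Proof.
elim: n k => [|n IHn] [|k]; rewrite ?qbin0 ?rmorph1 ?rmorph0 //.
by rewrite !qbinS rmorphD rmorphM rmorphXn !IHn.
Qed.

(** * Power series truncated by a nilpotent [q] *)

Section Nilpotent.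
Variables (R : comNzRingType) (q : R) (M : nat).
Hypotheses (M0 : (0 < M)%N) (qM : q ^+ M = 0).

Lemma expr_nilp n : (M <= n)%N -> q ^+ n = 0.
Proof. by move=> le_Mn; rewrite -(subnKC le_Mn) exprD qM mul0r. Qed.

Definition geom i : R := \sum_(k < M) q ^+ (i * k).

Lemma geomE i : (0 < i)%N -> (1 - q ^+ i) * geom i = 1.
Proof.
move=> i0; rewrite /geom; under eq_bigr do rewrite exprM.
by rewrite -[1 - _]opprB mulNr -subrX1 -exprM expr_nilp ?leq_pmull // sub0r opprK.
Qed.

Lemma qpoch_inv n : qpoch q n * \prod_(i < n) geom i.+1 = 1.
Proof. by rewrite -big_split big1 //= => i _; rewrite geomE. Qed.

Lemma qpoch_stable n : (M <= n)%N -> qpoch q n = qpoch q M.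
Proof.
move=> le_Mn; rewrite -(subnKC le_Mn); elim: (n - M)%N => [|k IHk].
  by rewrite addn0.
by rewrite addnS qpochS IHk expr_nilp ?subr0 ?mulr1 //; lia.
Qed.

(** All [qpoch q i] with [M <= i] are one and the same unit [u], so [qbin_qpoch] reads
    [qbin q n k * (u * u) = u]. This is the limit of a Gaussian binomial far from both ends. *)
Lemma qbin_qpoch1 n k m : (M <= k)%N -> (M + k <= n)%N -> (M <= m)%N ->
  qbin q n k * qpoch q m = 1.
Proof.
move=> le_Mk le_kn le_Mm; have le_kn' : (k <= n)%N by lia.
have := qbin_qpoch q le_kn'; rewrite !(@qpoch_stable _) //; try lia.
move=> /(congr1 ( *%R^~ (\prod_(i < M) geom i.+1))).
by rewrite -!mulrA qpoch_inv !mulr1.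
Qed.

End Nilpotent.

(** * The product formula for Schur's polynomials modulo a power of [q] *)

Section RogersRamanujan.
Variables (R : comNzRingType) (phi : {rmorphism {poly rat} -> R}).
Variables (c M : nat).
Hypotheses (c1 : (c <= 1)%N) (M0 : (0 < M)%N).
Let q : R := phi 'X.
Hypothesis qM : q ^+ M = 0.

(** A term survives only if its theta exponent is below [M], hence [|j| < M]; the bound on [n] then
    keeps the lower index at distance at least [M] from both 0 and [n], and [qbin_qpoch1]
    applies. *)
Lemma schur_limit B n m : (7 * M + 2 <= n)%N -> (M <= m)%N ->
  schur q c B n * qpoch q m = bisum B (fun j => (-1) ^+ `|j| * q ^+ theta_exp c j).
Proof.
move=> le_Mn le_Mm; rewrite /schur /bisum big_distrl; apply: eq_big_nat => i _ /=.
move: (i%:Z - _) => j; rewrite /schur_term -mulrA.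
have := theta_exp_ge j c1.
case: (leqP M (theta_exp c j)) => [le_Me _|lt_eM le_je].
  by rewrite (expr_nilp qM le_Me) !(mulr0, mul0r).
have [k [Dk leMk lekn]] : exists k, [/\ schur_idx c n j = Posz k, (M <= k)%N & (M + k <= n)%N].
  by exists `|schur_idx c n j|%N; rewrite /schur_idx; split; lia.
by rewrite Dk /qbz -!mulrA (qbin_qpoch1 M0 qM) ?mulr1.
Qed.

(** The image under [phi] of the identity over [{poly rat}]. For [|j| < M] the index [n - j] is at
    distance at least [M] from 0 and [2 * n], so the binomial in base [q ^+ 5] cancels
    [qpoch (q ^+ 5) n]. *)
Lemma jacobi_limit n : (2 * M <= n)%N ->
  qpoch (q ^+ 5) n *
   \prod_(k < n) ((1 - q ^+ (5 * k + (3 + c))) * (1 - q ^+ (5 * k + (2 - c)))) =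
  bisum n (fun j => (-1) ^+ `|j| * q ^+ theta_exp c j).
Proof.
move=> le_Mn.
have := @finite_jacobi_triple_product {poly rat} 'X c n (negbT (polyX_eq0 _)) c1.
move=> /(congr1 phi); rewrite rmorph_prod.
rewrite (eq_bigr (fun k : 'I_n => (1 - q ^+ (5 * k + (3 + c))) *
   (1 - q ^+ (5 * k + (2 - c))))); last first.
  by move=> k _; rewrite rmorphM !rmorphB !rmorph1 !rmorphXn.
move=> ->; rewrite /bisum rmorph_sum big_distrr; apply: eq_big_nat => i _ /=.
move: (i%:Z - _) => j; rewrite !rmorphM !rmorphXn rmorphN1 /=.
have := theta_exp_ge j c1.
case: (leqP M (theta_exp c j)) => [le_Me _|lt_eM le_je].
  by rewrite (expr_nilp qM le_Me) !(mulr0, mul0r).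
have [k [Dk leMk lekn]] : exists k, [/\ n%:Z - j = Posz k, (M <= k)%N & (M + k <= 2 * n)%N].
  by exists `|(n%:Z - j)%R|%N; split; lia.
rewrite Dk /= rmorph_qbin rmorphXn mulrC -!mulrA.
rewrite (@qbin_qpoch1 _ (q ^+ 5) M M0) ?mulr1 //; last lia.
by rewrite -exprM mulnC exprM qM expr0n.
Qed.

Lemma big_5block (F : nat -> R) n :
  \prod_(i < 5 * n) F i =
  \prod_(k < n) (F (5 * k)%N * F (5 * k + 1)%N * F (5 * k + 2)%N *
                 F (5 * k + 3)%N * F (5 * k + 4)%N).
Proof.
elim: n => [|n IHn]; first by rewrite !big_ord0.
rewrite [RHS]big_ord_recr /= -IHn -!(big_mkord xpredT F).
have -> : (5 * n.+1 = (5 * n).+4.+1)%N by lia.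
by rewrite !big_nat_recr //= !addnS addn0 !mulrA.
Qed.

Definition rr_part i := ((i %% 5 == 1 + c) || (i %% 5 == 4 - c))%N.

(** Sorted by residue modulo 5, the factors of [qpoch q (5 * B)] are those of [rr_part], the
    multiples of 5, and the two classes of the triple product. The last two groups form the theta
    series, so dividing it by [qpoch] leaves the inverses of the first. *)
Lemma rr_product n B : (7 * M + 2 <= n)%N -> (2 * M <= B)%N ->
  schur q c B n = \prod_(i < 5 * B | rr_part i.+1) geom q M i.+1.
Proof.
move=> le_Mn le_MB; pose D := (5 * B)%N; pose F i : R := 1 - q ^+ i.+1.
have DF : qpoch q D = \prod_(i < D | rr_part i.+1) F i *
    (qpoch (q ^+ 5) B * \prod_(k < B) ((1 - q ^+ (5 * k + (3 + c))) *
       (1 - q ^+ (5 * k + (2 - c))))).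
  rewrite /qpoch -(big_mkord xpredT F) [in RHS]big_mkcond /=.
  rewrite big_mkord (big_5block F) (big_5block (fun i => if rr_part i.+1 then F i else 1)).
  rewrite -!big_split; apply: eq_bigr => k _ /=.
  have rr_partE r : rr_part (5 * k + r).+1 = rr_part r.+1.
    by rewrite /rr_part -addnS mulnC modnMDl.
  have -> : rr_part (5 * k).+1 = rr_part 1 by rewrite -(rr_partE 0) addn0.
  rewrite !rr_partE /F -exprM /rr_part; case: c c1 => [|[|]] // _ /=;
  rewrite ?(addn0, addn1, addn2, addn3, addn4, mulnS, addSn, add0n); ring.
have inv_all : qpoch q D * \prod_(i < D) geom q M i.+1 = 1 by exact: qpoch_inv.
have inv_rr : \prod_(i < D | rr_part i.+1) F i *
    \prod_(i < D | rr_part i.+1) geom q M i.+1 = 1.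
  by rewrite -big_split big1 //= => i _; rewrite geomE.
have DX : schur q c B n * qpoch q D = qpoch (q ^+ 5) B *
    \prod_(k < B) ((1 - q ^+ (5 * k + (3 + c))) * (1 - q ^+ (5 * k + (2 - c)))).
  by rewrite schur_limit ?jacobi_limit // /D; lia.
move: DF DX inv_all inv_rr.
move: (qpoch q D) (qpoch (q ^+ 5) B * _) (\prod_(i < D) _) (\prod_(i < D | _) F i).
(* [R] may have zero divisors, so the cancellation uses the explicit inverses [G] of [P] and [g] of
   [a]. *)
move: (\prod_(i < D | _) _) (schur _ _ _ _) => g S P X G a DP DX PG ag.
rewrite -[LHS]mulr1 -PG mulrA DX -[LHS]mulr1 -ag.
by have -> : X * G * (a * g) = a * X * G * g; [ring | rewrite -DP PG mul1r].
Qed.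
End RogersRamanujan.

(** * Partitions of natural numbers *)

(* A set of parts is encoded by the bit sequence whose entry at index k tells
   whether k is a part; index 0 is always unset. *)
Section GapSequences.
Variable c : nat.

(** Splitting on whether the top index is a part makes the generating function obey Schur's
    recurrence; the case [n = 1] carries the exclusion of the part 1 when [c] is not 0. *)
Fixpoint gap_seqs (n : nat) : seq bitseq :=
  match n with
  | 0 => [:: [:: false]]
  | 1 => [:: false; false] :: if c == 0%N then [:: [:: false; true]] else [::]
  | (n'.+1 as n1).+1 => [seq rcons s false | s <- gap_seqs n1] ++
               [seq rcons (rcons s false) true | s <- gap_seqs n']
  end.

Lemma gap_seqsSS n : gap_seqs n.+2 = [seq rcons s false | s <- gap_seqs n.+1] ++
               [seq rcons (rcons s false) true | s <- gap_seqs n].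
Proof. by []. Qed.

Definition bit_weight (s : bitseq) : nat := \sum_(k < size s) k * nth false s k.

Lemma bit_weight_rcons s b : bit_weight (rcons s b) = (bit_weight s + size s * b)%N.
Proof.
rewrite /bit_weight size_rcons big_ord_recr /= nth_rcons ltnn eqxx; congr (_ + _)%N.
by apply: eq_bigr => i _; rewrite nth_rcons ltn_ord.
Qed.

Lemma size_gap_seqs n s : s \in gap_seqs n -> size s = n.+1.
Proof.
elim/ltn_ind: n s => -[|[|n]] IHn s; first by rewrite inE => /eqP ->.
  by rewrite inE => /orP[/eqP ->//|]; case: eqP => // _; rewrite inE => /eqP ->.
by rewrite gap_seqsSS mem_cat => /orP[] /mapP[t /IHn St ->]; rewrite !size_rcons St.
Qed.

Lemma gap_seqs_uniq n : uniq (gap_seqs n).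
Proof.
elim/ltn_ind: n => -[|[|n]] IHn //; first by rewrite /=; case: eqP.
rewrite gap_seqsSS cat_uniq !map_inj_uniq ?IHn ?andbT //.
- by apply/hasPn => _ /mapP[s _ ->]; apply/mapP => -[t _] /rcons_inj[].
- by move=> s t /rcons_inj[/rcons_inj[]].
- by move=> s t /rcons_inj[].
Qed.

(** One inequality rules out both repeated and consecutive parts. *)
Definition gap_fun (f : nat -> nat) : Prop :=
  (forall k, f k + f k.+1 <= 1)%N /\ (c != 0%N -> f 1%N = 0%N).

Lemma nth_rcons_false t k : nth false (rcons t false) k = nth false t k.
Proof. by rewrite nth_rcons; case: ltngtP => // ?; rewrite nth_default //; lia. Qed.

Lemma nth_rcons_true t k :
  nth false (rcons t true) k = (k == size t) || nth false t k.
Proof.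
by rewrite nth_rcons; case: ltngtP => //= ?; rewrite ?nth_default //; lia.
Qed.

Lemma mem_gap_seqs n (s : bitseq) : s \in gap_seqs n <->
  [/\ size s = n.+1, nth false s 0 = false & gap_fun (nth false s)].
Proof.
elim/ltn_ind: n s => -[|[|n]] IHn s.
- rewrite inE; split=> [/eqP ->|].
    by split=> //; split=> [k|_]; rewrite ?nth_nseq //; case: k => [|[]].
  by case: s => [|b [|? ?]] [] //= _ ->.
- rewrite inE; split.
    case/orP=> [/eqP ->|]; first by split=> //; split=> // -[|[|[|k]]].
    case: eqP => // c0; rewrite inE => /eqP ->.
    by split=> //; split=> [[|[|[|k]]]|]; rewrite ?c0.
  case: s => [|b [|b' [|? ?]]] [] //= _ -> [_]; case: b' => //=.
  by case: (c == 0%N) => // /(_ isT).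
rewrite gap_seqsSS mem_cat; split.
  case/orP => /mapP[t t_in ->].
    have [St t0 [gap_t t1]] := (IHn n.+1 (ltnSn _) t).1 t_in.
    split; rewrite ?size_rcons ?St ?nth_rcons_false //.
    by split=> [k|c0]; rewrite !nth_rcons_false ?t1.
  have [St t0 [gap_t t1]] := (IHn n (ltnW (ltnSn _)) t).1 t_in.
  have Er k : nth false (rcons (rcons t false) true) k = (k == n.+2) || nth false t k.
    by rewrite nth_rcons_true nth_rcons_false size_rcons St.
  split; rewrite ?size_rcons ?St ?Er //.
  split=> [k|c0]; last by rewrite Er /= t1.
  rewrite !Er; have := gap_t k; have: (n < k)%N -> nth false t k = false.
    by move=> ?; rewrite nth_default // St.
  have: (n <= k)%N -> nth false t k.+1 = false.
    by move=> ?; rewrite nth_default // St.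
  case: (nth false t k) (nth false t k.+1) => -[] /=; case: eqP; case: eqP => //=; lia.
case; elim/last_ind: s => // t b _; rewrite size_rcons => -[St] s0 [gap_s s1].
apply/orP; case: b s0 gap_s s1 => s0 gap_s s1; last first.
  left; apply/map_f/IHn => //; split=> //; rewrite ?nth_rcons_false // in s0 *.
  split=> [k|/s1]; last by rewrite nth_rcons_false.
  by have := gap_s k; rewrite !nth_rcons_false.
right; elim/last_ind: t St s0 gap_s s1 => // u b _; rewrite size_rcons => -[Su] s0 gap_s s1.
have Du k : k != n.+2 -> nth false (rcons (rcons u b) true) k = nth false (rcons u b) k.
  by move=> /negPf kn; rewrite nth_rcons_true size_rcons Su kn.
(* The bit at [n.+2] is set, so the gap condition at [n.+1] clears the bit before it. *)
have Db : b = false.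
  have := gap_s n.+1; rewrite Du ?nth_rcons_true ?size_rcons ?Su ?eqxx; last by lia.
  by rewrite nth_rcons Su ltnn eqxx; case: (b).
subst b; apply: map_f; apply/IHn => //.
split=> //; first by rewrite -nth_rcons_false -Du.
split=> [k|/s1]; last by rewrite Du ?nth_rcons_false.
case: (ltnP k n.+1) => lt_kn.
  by have := gap_s k; rewrite !Du ?nth_rcons_false //; lia.
by rewrite !nth_default //; lia.
Qed.

(** Both sides obey the same recurrence. Parts at most [n] correspond to the index [n.+1], so
    [schur0] enters only as the coefficient of [q] in the case [n = 1]. *)
Lemma gap_seqs_gf (R : comNzRingType) (q : R) B n : (c <= 1)%N -> (n.+1 <= B)%N ->
  \sum_(s <- gap_seqs n) q ^+ bit_weight s = schur q c B n.+1.
Proof.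
move=> c1; elim/ltn_ind: n => -[|[|n]] IHn lt_nB.
- by rewrite schur1 // big_seq1 /bit_weight big_ord1 expr0.
- rewrite schur_rec // schur1 // schur0 // big_cons.
  rewrite /bit_weight /= !big_ord_recr !big_ord0 /= expr0 expr1; congr (_ + _).
  case: c c1 => [|[]] // _; last by rewrite big_nil mulr0.
  by rewrite big_seq1 !big_ord_recr !big_ord0 /= mulr1.
- rewrite schur_rec // -!IHn //; try lia.
  rewrite gap_seqsSS big_cat !big_map big_distrr /=; congr (_ + _).
    by apply: eq_bigr => s _; rewrite bit_weight_rcons muln0 addn0.
  rewrite big_seq_cond [RHS]big_seq_cond; apply: eq_bigr => s /andP[/size_gap_seqs Ss _].
  rewrite !bit_weight_rcons size_rcons Ss muln0 muln1 addn0 -exprD.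
  by rewrite addnC.
Qed.

End GapSequences.

(* A partition of m is given by its multiplicities. *)
Definition partfun (m : nat) (f : nat -> nat) : Prop :=
  [/\ f 0%N = 0%N, forall k, (m < k)%N -> f k = 0%N & (\sum_(k < m.+1) k * f k = m)%N].

Lemma partfun_sum m f N : (forall k, (m < k)%N -> f k = 0%N) -> (m < N)%N ->
  (\sum_(k < N) k * f k = \sum_(k < m.+1) k * f k)%N.
Proof.
move=> fm lt_mN; rewrite -!(big_mkord xpredT (fun k => k * f k)%N).
rewrite (@big_cat_nat _ _ _ m.+1 0 N) //= [X in (_ + X)%N]big1_seq ?addn0 // => k.
by rewrite mem_index_iota => /andP[_ /andP[lt_mk _]]; rewrite fm ?muln0.
Qed.

Lemma partfunP m f N : (m < N)%N -> f 0%N = 0%N -> (forall k, (N <= k)%N -> f k = 0%N) ->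
  (\sum_(k < N) k * f k = m)%N -> partfun m f.
Proof.
move=> lt_mN f0 fN fm; have fm0 k : (m < k)%N -> f k = 0%N.
  move=> lt_mk; case: (ltnP k N) => [lt_kN|/fN //].
  have := fm; rewrite (bigD1 (Ordinal lt_kN)) //=; case: (f k) => // a; nia.
by split=> //; rewrite -(partfun_sum fm0 lt_mN).
Qed.

Lemma partfun_le m f k : partfun m f -> (f k <= m)%N.
Proof.
case=> f0 fm0 fm; case: k => [|k]; first by rewrite f0.
case: (ltnP m k.+1) => [/fm0 ->//|lt_km].
have lt_km1 : (k.+1 < m.+1)%N by [].
by move: fm; rewrite (bigD1 (Ordinal lt_km1)) //=; nia.
Qed.

(** * From generating functions to cardinalities *)

Lemma coef_sum_Xn (R : nzRingType) (I : Type) (r : seq I) (w : I -> nat) m :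
  (\sum_(i <- r) ('X : {poly R}) ^+ w i)`_m = (count (fun i => w i == m) r)%:R.
Proof.
elim: r => [|i r IHr]; first by rewrite big_nil coef0.
by rewrite big_cons coefD coefXn IHr /= natrD eq_sym.
Qed.

Lemma in_qpolyXn_coef (p r : {poly rat}) m :
  in_qpoly 'X^(m.+1) p = in_qpoly 'X^(m.+1) r -> p`_m = r`_m.
Proof.
move/(congr1 val); rewrite /= mk_monic_Xn /= => Epr.
have coefE (s : {poly rat}) : s`_m = (Pdiv.Ring.rmodp s 'X^(m.+1))`_m.
  rewrite {1}(Pdiv.RingMonic.rdivp_eq (monicXn _ m.+1) s).
  by rewrite coefD coefMXn ltnSn add0r.
by rewrite coefE Epr -coefE.
Qed.

(** Both counts are coefficients of degree [m], compared modulo ['X^(m.+1)]; the bound on [n] is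
    that of [rr_product] for [M = m.+1] at the index [n.+1]. An index [i] of [f] stands for the part
    [i.+1]. *)
Lemma rr_count c m n : (c <= 1)%N -> (7 * m.+1 + 1 <= n)%N ->
  let L := (5 * n.+1)%N in
  #|[set f : {ffun 'I_L -> 'I_m.+1} |
       (f \in family (fun i : 'I_L => [pred k : 'I_m.+1 | rr_part c i.+1 || (k == ord0)]))
       && (\sum_(i < L) i.+1 * f i == m)%N]%SET|
  = size [seq s <- gap_seqs c n | bit_weight s == m].
Proof.
move=> c1 le_mn L; set fam := family _.
pose w (f : {ffun 'I_L -> 'I_m.+1}) := (\sum_(i < L) i.+1 * f i)%N.
pose PA : {poly rat} := \sum_(f <- enum fam) 'X^(w f).
pose PB : {poly rat} := \sum_(s <- gap_seqs c n) 'X^(bit_weight s).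
suff: PA`_m = PB`_m.
  rewrite !coef_sum_Xn => /eqP; rewrite eqr_nat => /eqP; rewrite size_filter => <-.
  rewrite cardE /enum_mem -size_filter; congr size.
  by rewrite -filter_predI; apply: eq_filter => f; rewrite !inE andbC.
apply: in_qpolyXn_coef; pose q := in_qpoly 'X^(m.+1) ('X : {poly rat}).
have qM : q ^+ m.+1 = 0.
  rewrite -rmorphXn; apply: val_inj; rewrite /= mk_monic_Xn /=.
  by rewrite Pdiv.RingMonic.rmodpp ?monicXn.
rewrite /PA /PB !rmorph_sum.
under eq_bigr do rewrite rmorphXn.
under [RHS]eq_bigr do rewrite rmorphXn.
rewrite -/q (@gap_seqs_gf c _ q n.+1) //.
rewrite (@rr_product _ (in_qpoly 'X^(m.+1) : {rmorphism {poly rat} -> _})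
   c m.+1 c1 isT qM n.+1 n.+1) //; try lia.
(* The product is extended to all [i]: outside [rr_part] only the multiplicity 0 is allowed, which
   gives a factor 1. Distributivity then produces the sum over [fam]. *)
rewrite [RHS]big_mkcond /= [RHS](eq_bigr (fun i : 'I_L =>
  \sum_(k < m.+1 | rr_part c i.+1 || (k == ord0)) q ^+ (i.+1 * k))); last first.
  move=> i _; case: (rr_part c i.+1) => //=.
  by rewrite (big_pred1 ord0) //= muln0 expr0.
rewrite bigA_distr_big_dep big_enum /=.
by apply: eq_bigr => f _; rewrite /w -expr_sum.
Qed.

Local Open Scope quotient_scope.
Local Open Scope classical_set_scope.
Local Open Scope card_scope.

Lemma card_image_seq (T : choiceType) U (f : T -> U) (s : seq T) :
  uniq s -> {in s &, injective f} -> f @` [set x | x \in s] #= `I_(size s).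
Proof.
move=> Us inj_f; apply: card_eq_trans (inj_card_eq _) _.
  by move=> x y; rewrite !inE; apply: inj_f.
have -> : [set x | x \in s] = [set` [fset x in s]%fset].
  by apply/seteqP; split=> x /=; rewrite inE.
by apply/card_eq_fsetP; rewrite card_fseq undup_id.
Qed.

Definition ffun_mult L m (f : {ffun 'I_L -> 'I_m.+1}) (k : nat) : nat :=
  if k is k'.+1 then oapp (fun i => nat_of_ord (f i)) 0%N (insub k') else 0%N.

Lemma ffun_multS L m (f : {ffun 'I_L -> 'I_m.+1}) (i : 'I_L) :
  ffun_mult f i.+1 = f i.
Proof. by rewrite /ffun_mult valK. Qed.

Lemma ffun_mult_out L m (f : {ffun 'I_L -> 'I_m.+1}) k :
  (L < k)%N -> ffun_mult f k = 0%N.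
Proof. by case: k => // k lt_Lk; rewrite /ffun_mult insubF //; lia. Qed.

Lemma rr_funE c m L : (m <= L)%N ->
  [set f | partfun m f /\ forall k, f k <> 0%N -> rr_part c k] =
  @ffun_mult L m @` [set f | f \in enum [set f : {ffun 'I_L -> 'I_m.+1} |
       (f \in family (fun i : 'I_L => [pred k : 'I_m.+1 | rr_part c i.+1 || (k == ord0)]))
       && (\sum_(i < L) i.+1 * f i == m)%N]%SET].
Proof.
move=> le_mL; apply/seteqP; split=> [f [Pf rr_f]|_ [f + <-]] /=; last first.
  rewrite /mkset mem_enum inE => /andP[/familyP rr_f /eqP Sf]; split.
    apply: (@partfunP m _ L.+1) => //; first exact: ffun_mult_out.
    rewrite big_ord_recl mul0n add0n -[RHS]Sf; apply: eq_bigr => i _.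
    by rewrite lift0 ffun_multS.
  case=> // k; case: (ltnP k L) => [lt_kL|? []]; last exact: ffun_mult_out.
  rewrite -[k]/(nat_of_ord (Ordinal lt_kL)) ffun_multS.
  by have := rr_f (Ordinal lt_kL); rewrite inE => /orP[//|/eqP ->] [].
have [f0 fm Sf] := Pf.
exists [ffun i : 'I_L => inord (f i.+1)]; last first.
  apply/funext => -[|k]; first by rewrite f0.
  case: (ltnP k L) => [lt_kL|le_Lk]; last by rewrite ffun_mult_out ?fm //; lia.
  rewrite -[k in LHS]/(nat_of_ord (Ordinal lt_kL)) ffun_multS ffunE inordK //.
  by rewrite ltnS (partfun_le _ Pf).
rewrite /mkset mem_enum inE; apply/andP; split.
  apply/familyP => i; rewrite inE ffunE; case: (f i.+1 =P 0%N) => [->|/rr_f -> //].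
  by rewrite orbC -val_eqE /= inordK.
apply/eqP; rewrite -[RHS]Sf -(partfun_sum fm (N := L.+1)) // big_ord_recl mul0n.
rewrite add0n; apply: eq_bigr => i _.
by rewrite lift0 ffunE inordK // ltnS (partfun_le _ Pf).
Qed.

Lemma gap_funE c m n : (m <= n)%N ->
  [set f | partfun m f /\ gap_fun c f] =
  (fun (s : bitseq) (k : nat) => nat_of_bool (nth false s k)) @`
    [set s | s \in [seq s <- gap_seqs c n | bit_weight s == m]].
Proof.
move=> le_mn; apply/seteqP; split=> [f [Pf gap_f]|_ [s + <-]] /=; last first.
  rewrite /mkset mem_filter => /andP[/eqP Ws /mem_gap_seqs[Ss s0 gap_s]]; split=> //.
  apply: (@partfunP m _ (size s)); rewrite ?Ss ?ltnS ?s0 //.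
    by move=> k le_k; rewrite nth_default // Ss.
  by rewrite -Ss.
have [f0 fm Sf] := Pf; have [f_le1 f1] := gap_f.
have Ef k : nat_of_bool (nth false (mkseq (fun k => f k != 0%N) n.+1) k) = f k.
  case: (ltnP k n.+1) => [lt_kn|le_nk].
    by rewrite nth_mkseq //; have := f_le1 k; case: (f k) => [|[|]].
  by rewrite nth_default ?size_mkseq // fm //; lia.
exists (mkseq (fun k => f k != 0%N) n.+1); last exact/funext.
rewrite /mkset mem_filter; apply/andP; split.
  rewrite /bit_weight size_mkseq; apply/eqP; under eq_bigr do rewrite Ef.
  by rewrite (partfun_sum fm).
apply/mem_gap_seqs; rewrite size_mkseq; split=> //; first by rewrite nth_mkseq // f0.
by split=> [k|c0]; rewrite !Ef // f1.
Qed.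

(** The first identity for [c = 0], the second for [c = 1]: both sets are injective images of the
    finite collections counted in [rr_count]. *)
Lemma rogers_ramanujan c m : (c <= 1)%N ->
  [set f | partfun m f /\ forall k, f k <> 0%N -> rr_part c k] #=
  [set f | partfun m f /\ gap_fun c f].
Proof.
move=> c1; pose n := (7 * m.+1 + 1)%N.
rewrite (@rr_funE c m (5 * n.+1)) ?(@gap_funE c m n) /n; [|lia|lia].
apply: (card_eq_trans (card_image_seq _ _)); first exact: enum_uniq.
  move=> f g _ _ Efg; apply/ffunP => i; apply: val_inj.
  by rewrite /= -!ffun_multS Efg.
rewrite -cardE rr_count //; apply: card_esym; apply: card_image_seq.
  by rewrite filter_uniq ?gap_seqs_uniq.
move=> s t; rewrite !mem_filter => /andP[_ /size_gap_seqs Ss] /andP[_ /size_gap_seqs St] Est.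
apply: (@eq_from_nth _ false) => [|k _]; first by rewrite Ss.
by have := congr1 (@^~ k) Est => /=; case: (nth _ s k) (nth _ t k) => -[].
Qed.

(** * Sections *)

Lemma partfun_uniq m m' f : partfun m f -> partfun m' f -> m = m'.
Proof.
move=> [_ fm <-] [_ fm' <-].
rewrite -(partfun_sum fm (N := (m + m').+1)) ?ltnS ?leq_addr //.
by rewrite -(partfun_sum fm' (N := (m + m').+1)) ?ltnS ?leq_addl.
Qed.

Lemma partfun_exists f N : f 0%N = 0%N -> (forall k, (N < k)%N -> f k = 0%N) ->
  partfun (\sum_(k < N.+1) k * f k)%N f.
Proof.
move=> f0 fN; set m := (\sum_(k < _) _)%N.
apply: (@partfunP _ _ (N + m).+1) => //; first by rewrite ltnS leq_addl.
  by move=> k lt_k; apply: fN; lia.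
by rewrite (partfun_sum fN) // ltnS leq_addr.
Qed.

Lemma partfun0 f k : partfun 0 f -> f k = 0%N.
Proof. by case=> f0 fp _; case: k => // k; apply: fp. Qed.

Lemma sum_seq_count (V : nmodType) (s S : seq V) : uniq S -> {subset s <= S} ->
  \sum_(x <- s) x = \sum_(x <- S) x *+ count_mem x s.
Proof.
move=> US; elim: s => [|a s IHs] sS; first by rewrite big_nil big1.
rewrite big_cons IHs => [|x xs]; last by apply: sS; rewrite inE xs orbT.
under [RHS]eq_bigr do rewrite mulrnDr.
rewrite big_split /=; congr (_ + _).
rewrite (bigD1_seq a) ?sS ?mem_head //= eqxx mulr1n big1 ?addr0 // => x.
by rewrite eq_sym => /negPf ->.
Qed.

Section Sections.
Variable K : fieldExtType rat.
Local Notation O := (ring_of_integers K).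
Implicit Types (l : {mset O}%mset) (t x : O) (k m : nat).

Lemma scale_primitiveMn t k : primitive t -> (0 < k)%N ->
  [/\ Oplus (t *+ k), scale (t *+ k) = k & primitive_factor (t *+ k) = t].
Proof.
move=> t_prim k0; have tk_pos : Oplus (t *+ k) by apply/OplusMn => //; case: t_prim.
suff [] : (scale (t *+ k), primitive_factor (t *+ k)) = (k, t) by [].
by apply: scale_factorization_uniq (scale_factorization_exists tk_pos) _; split.
Qed.

Lemma scaleE x : Oplus x ->
  [/\ (0 < scale x)%N, primitive (primitive_factor x) & x = primitive_factor x *+ scale x].
Proof. exact: scale_factorization_exists. Qed.

(* Scale 0 is not a part: 0 is sent to 0 whatever l 0 is. *)
Definition section_mult l t k : nat := if k is 0 then 0%N else l (t *+ k).

Definition max_scale l : nat := \max_(x <- l) scale x.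

(** For primitive [t], this is the integer partitioned by the section of [t]: multiplicities beyond
    [max_scale l] vanish. *)
Definition section_weight l t : nat :=
  (\sum_(k < (max_scale l).+1) k * section_mult l t k)%N.

Lemma section_mult_out l t k : primitive t -> (max_scale l < k)%N ->
  section_mult l t k = 0%N.
Proof.
case: k => // k t_prim; rewrite ltnNge /= => le_kN; apply/mset_eq0P.
apply: contraNN le_kN => tk_l; have [_ <- _] := scale_primitiveMn t_prim (ltn0Sn k).
by rewrite /max_scale (big_rem _ tk_l) /= leq_maxl.
Qed.

Lemma section_weightP l t : primitive t ->
  partfun (section_weight l t) (section_mult l t).
Proof. by move=> t_prim; apply: partfun_exists => // k; apply: section_mult_out. Qed.

Lemma section_sum l t m N : primitive t -> (max_scale l <= N)%N ->
  partfun m (section_mult l t) -> (\sum_(k < N.+1) k * section_mult l t k = m)%N.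
Proof.
move=> t_prim le_N; apply: partfun_uniq; apply: partfun_exists => // k lt_k.
by apply: section_mult_out => //; apply: leq_ltn_trans lt_k.
Qed.

(** [T] and [N] may be larger than [l] requires, so that two partitions can be summed over the same
    indices. No [t *+ k] is listed twice, by uniqueness of the factorization. *)
Lemma sum_sections l (T : seq O) N : uniq T -> {in T, forall t, primitive t} ->
    (forall x, x \in l -> Oplus x) ->
    (forall x, x \in l -> primitive_factor x \in T) ->
    (forall x, x \in l -> (scale x <= N)%N) ->
  \sum_(x <- l) x = \sum_(t <- T) t *+ (\sum_(k < N.+1) k * section_mult l t k).
Proof.
move=> UT Tprim lpos lT lN.
rewrite (@sum_seq_count _ l [seq t *+ k | t <- T, k <- iota 1 N]).
- rewrite big_allpairs_dep; rewrite big_seq_cond [RHS]big_seq_cond.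
  apply: eq_bigr => t _; rewrite -(big_mkord xpredT (fun k => k * section_mult l t k)%N).
  rewrite big_ltn // mul0n add0n -sumrMnr /index_iota subn1 /=.
  apply: eq_big_seq => k; rewrite mem_iota => /andP[k0 _].
  by rewrite count_mem_mset mulrnA; case: k k0.
- apply: allpairs_uniq => //; first exact: iota_uniq.
  move=> _ _ /allpairsP[[t k] /= [tT kN ->]] /allpairsP[[t' k'] /= [tT' kN' ->]] /= Ett.
  rewrite !mem_iota in kN kN'; case/andP: kN kN' => k0 _ /andP[k0' _].
  have [_ sk pk] := scale_primitiveMn (Tprim _ tT) k0.
  have [_ sk' pk'] := scale_primitiveMn (Tprim _ tT') k0'.
  by congr pair; [rewrite -pk -pk' Ett | rewrite -sk -sk' Ett].
- move=> x xl; have [s0 _ ->] := scaleE (lpos _ xl).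
  by apply: allpairs_f; rewrite ?lT // mem_iota add1n ltnS s0 lN.
Qed.

(** In each section, apply an injection between ordinary partitions of its weight. Weights are kept,
    hence so is the sum [d]. Injections suffice, as Cantor-Bernstein will give equal cardinality. *)
Lemma glue_sections (d : O) (P Q : O -> (nat -> nat) -> Prop) :
  (forall t m, primitive t ->
     [set f | partfun m f /\ P t f] #<= [set f | partfun m f /\ Q t f]) ->
  [set l | is_partition d l /\ forall t, primitive t -> P t (section_mult l t)] #<=
  [set l | is_partition d l /\ forall t, primitive t -> Q t (section_mult l t)].
Proof.
move=> PQ.
(* One map is chosen for each section and weight, with the identity as default when [tm.1] is not
   primitive. *)
have /choice[g gP] (tm : O * nat) : exists g : (nat -> nat) -> (nat -> nat),
    primitive tm.1 ->
    (forall f, partfun tm.2 f -> P tm.1 f -> partfun tm.2 (g f) /\ Q tm.1 (g f)) /\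
    (forall f f', partfun tm.2 f -> P tm.1 f -> partfun tm.2 f' -> P tm.1 f' ->
       g f = g f' -> f = f').
  case: (pselect (primitive tm.1)) => [t_prim|]; last by exists id.
  have /pcard_leP/injfunPex[g g1 g2] := PQ _ tm.2 t_prim.
  exists g => _; split=> [f mf Pf|f f' mf Pf mf' Pf']; first exact: g1.
  by apply: g2; rewrite inE.
pose h l t := g (t, section_weight l t) (section_mult l t).
(* A finite support for the image: a part of a partition of the weight is at most the weight, and
   empty sections stay empty. *)
pose S l := [fset x in [seq t *+ k | t <- map (@primitive_factor K) l,
                                 k <- iota 1 (section_weight l t)]]%fset.
pose Phi l : {mset O}%mset := [fsfun x in S l => h l (primitive_factor x) (scale x)].
set A := [set l | _ /\ _]; set A' := [set l | _ /\ _].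
have hP l t : A l -> primitive t -> partfun (section_weight l t) (h l t) /\ Q t (h l t).
  move=> [_ Pl] t_prim; have [/= g1 _] := gP (t, section_weight l t) t_prim.
  by apply: g1; [apply: section_weightP | apply: Pl].
have SP l x : A l -> x \in S l -> exists t k,
    [/\ t \in map (@primitive_factor K) l, primitive t, (0 < k)%N,
        (k <= section_weight l t)%N & x = t *+ k].
  move=> [[lpos _] _]; rewrite inE => /allpairsPdep[t [k [tl kN ->]]].
  exists t, k; rewrite mem_iota add1n ltnS in kN; case/andP: kN => k0 kN.
  by split=> //; case/mapP: tl => y /lpos/scaleE[_ ? _] ->.
have secPhi l t : A l -> primitive t -> section_mult (Phi l) t = h l t.
  move=> Al t_prim; have [mh _] := hP l t Al t_prim.
  apply/funext => -[|k]; first by case: mh.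
  have [_ sc pf] := scale_primitiveMn t_prim (ltn0Sn k).
  rewrite /section_mult /Phi fsfunE; case: ifPn => [_|tkS]; first by rewrite sc pf.
  case: (boolP (t \in map (@primitive_factor K) l)) => [tl|tl].
    have [_ hm _] := mh; rewrite hm // ltnNge; apply: contraNN tkS => kN.
    rewrite inE; apply/allpairsPdep; exists t, k.+1; split=> //.
    by rewrite mem_iota /= add1n ltnS.
  have w0 : section_weight l t = 0%N.
    rewrite /section_weight big1 // => -[[|i] lti] _ //=.
    rewrite (_ : l _ = 0%N) ?muln0 //; apply/mset_eq0P; apply: contraNN tl => til.
    apply/mapP; exists (t *+ i.+1) => //.
    by have [_ _ ->] := scale_primitiveMn t_prim (ltn0Sn i).
  by rewrite w0 in mh; rewrite (partfun0 _ mh).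
have Phi_pos l x : A l -> x \in Phi l -> Oplus x.
  move=> Al; rewrite in_mset fsfunE; case: ifP => // /(SP _ _ Al)[t [k [_ t_prim k0 _ ->]]] _.
  by have [] := scale_primitiveMn t_prim k0.
have PhiA' : Phi @` A `<=` A'.
  move=> _ [l Al <-]; have [[lpos sum_l] Pl] := Al.
  split; last by move=> t t_prim; rewrite secPhi //; case: (hP l t Al t_prim).
  split=> [x|]; first exact: Phi_pos.
  (* [Phi l] meets no section outside those of [l], so one [T] serves both sums. *)
  pose T := undup (map (@primitive_factor K) l).
  pose N := maxn (max_scale l) (max_scale (Phi l)).
  have Tprim : {in T, forall t, primitive t}.
    by move=> t; rewrite mem_undup => /mapP[x /lpos/scaleE[_ ? _] ->].
  have max_scaleP (l' : {mset O}%mset) x : x \in l' -> (scale x <= max_scale l')%N.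
    by move=> xl; rewrite /max_scale (big_rem _ xl) /= leq_maxl.
  rewrite -sum_l !(@sum_sections _ T N) ?undup_uniq //.
  - rewrite big_seq [RHS]big_seq; apply: eq_bigr => t /Tprim t_prim; congr (_ *+ _).
    have [mh _] := hP l t Al t_prim; rewrite -secPhi // in mh.
    rewrite (section_sum t_prim _ mh) ?leq_maxr //.
    by rewrite (section_sum t_prim _ (section_weightP l t_prim)) ?leq_maxl.
  - by move=> x xl; rewrite mem_undup map_f.
  - by move=> x /max_scaleP /leq_trans -> //; rewrite leq_maxl.
  - by move=> x; apply: Phi_pos.
  - move=> x; rewrite in_mset fsfunE; case: ifP => // /(SP _ _ Al)[t [k [tl t_prim k0 _ ->]]] _.
    by have [_ _ ->] := scale_primitiveMn t_prim k0; rewrite mem_undup.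
  - by move=> x /max_scaleP /leq_trans -> //; rewrite leq_maxr.
apply: card_le_trans (subset_card_le PhiA').
suff /inj_card_eq : {in A &, injective Phi} by rewrite card_eq_sym card_eq_le => /andP[].
move=> l l'; rewrite !inE => Al Al' EPhi; apply/msetP => x.
have sec_eq t : primitive t -> section_mult l t = section_mult l' t.
  move=> t_prim; have Eh : h l t = h l' t by rewrite -!secPhi ?EPhi.
  have [mh _] := hP l t Al t_prim; have [mh' _] := hP l' t Al' t_prim.
  (* The chosen map depends on the weight, which is recovered from the image because [h l t]
     partitions it. *)
  have Ew : section_weight l t = section_weight l' t.
    by apply: partfun_uniq mh _; rewrite Eh.
  have [/= _ g2] := gP (t, section_weight l t) t_prim.
  apply: g2 => /=.
  - exact: section_weightP.
  - by case: Al => _; apply.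
  - by rewrite Ew; apply: section_weightP.
  - by case: Al' => _; apply.
  - by move: Eh; rewrite /h Ew.
case: (pselect (Oplus x)) => [/scaleE[s0 t_prim ->]|nx].
  by have := congr1 (@^~ (scale x)) (sec_eq _ t_prim); case: (scale x) s0.
have out (l1 : {mset O}%mset) : A l1 -> l1 x = 0%N.
  by move=> [[l1pos _] _]; apply/mset_eq0P/negP => /l1pos.
by rewrite !out.
Qed.
End Sections.

(** * The gap condition, section by section *)

Lemma count_mem_ge2P (T : eqType) (x0 x : T) s :
  (2 <= count_mem x s)%N <->
  exists a b, [/\ (a < b < size s)%N, nth x0 s a = x & nth x0 s b = x].
Proof.
split=> [cx|[a [b [/andP[lt_ab lt_bs] sa sb]]]].
  have xs : x \in s by rewrite -has_pred1 has_count ltnW.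
  have lt_a : (index x s < size s)%N by rewrite index_mem.
  have Ds : s = take (index x s) s ++ x :: drop (index x s).+1 s.
    by rewrite -{1}(cat_take_drop (index x s) s) (drop_nth x0) ?nth_index.
  have xd : x \in drop (index x s).+1 s.
    rewrite -has_pred1 has_count; move: cx; rewrite {1}Ds count_cat /= eqxx.
    suff /count_memPn -> : x \notin take (index x s) s by [].
    by rewrite in_take_leq ?ltnn // ltnW.
  exists (index x s), ((index x s).+1 + index x (drop (index x s).+1 s))%N.
  rewrite nth_index // -nth_drop nth_index //; split=> //.
  have := xd; rewrite -index_mem size_drop; lia.
rewrite -(cat_take_drop b s) count_cat -[2%N]addn1 leq_add // -has_count has_pred1.
  by rewrite -sa -(nth_take x0 lt_ab) mem_nth // size_take lt_bs.
by rewrite -sb -[b in nth _ _ b]addn0 -nth_drop mem_nth // size_drop subn_gt0.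
Qed.

Section GapCondition.
Variable K : fieldExtType rat.
Local Notation O := (ring_of_integers K).
Implicit Types (l : {mset O}%mset) (t x : O) (k m : nat).

(** The gap fails in a section exactly when two positions carry equal or consecutive scales. Equal
    scales mean a multiplicity of at least 2, which [count_mem_ge2P] relates to positions. *)
Lemma scale_gap2P l : (forall x, x \in l -> Oplus x) ->
  scale_gap2 l <-> forall t, primitive t ->
    forall k, (section_mult l t k + section_mult l t k.+1 <= 1)%N.
Proof.
move=> lpos; have gt1E x := count_mem_ge2P 0 x (l : seq O).
split=> [gap_l t t_prim k|gap_l].
  have le1 j : (section_mult l t j <= 1)%N.
    case: j => // j; rewrite /section_mult leqNgt -(count_mem_mset (t *+ j.+1) l).
    apply/negP => /gt1E[a [b [/andP[lt_ab lt_b] la lb]]].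
    have := gap_l a b (ltn_trans lt_ab lt_b) lt_b; rewrite la lb.
    by move=> /(_ _ erefl); rewrite (ltn_eqF lt_ab) => /(_ isT); lia.
  have := le1 k; have := le1 k.+1.
  case: k => // k; rewrite /section_mult.
  case: (posnP (l (t *+ k.+1))) => [->|x_l] //; case: (posnP (l (t *+ k.+2))) => [->|y_l].
    by rewrite addn0.
  rewrite -!in_mset in x_l y_l; have x_i := x_l; have y_i := y_l.
  rewrite -index_mem in x_i; rewrite -index_mem in y_i.
  have := gap_l _ _ x_i y_i; rewrite /= !nth_index //.
  have [_ sx px] := scale_primitiveMn t_prim (ltn0Sn k).
  have [_ sy py] := scale_primitiveMn t_prim (ltn0Sn k.+1).
  rewrite sx sy px py => gap_xy; have := gap_xy _ erefl.
  suff -> : index (t *+ k.+1) l != index (t *+ k.+2) l by move=> /(_ isT); lia.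
  apply/eqP => Ei; have : t *+ k.+1 = t *+ k.+2.
    by rewrite -(nth_index 0 x_l) Ei nth_index.
  by move/(congr1 (@scale K)); rewrite sx sy; lia.
move=> a b; wlog lt_ab : a b / (a < b)%N.
  move=> IH la lb; rewrite neq_lt => /orP[lt_ab|lt_ba] /= Epf.
    by apply: IH; rewrite ?lt_eqF.
  have := IH b a lt_ba lb la; rewrite lt_eqF // => /(_ isT) /= /(_ (esym Epf)); lia.
move=> la lb _ /= Epf; set x := nth 0 l a in Epf *; set y := nth 0 l b in Epf *.
have [x_l y_l] : x \in l /\ y \in l by rewrite !mem_nth.
have [sx0 t_prim Dx] := scaleE (lpos _ x_l); have [sy0 _ Dy] := scaleE (lpos _ y_l).
rewrite -Epf in Dy; rewrite leqNgt; apply/negP => lt2.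
have secE k : (0 < k)%N -> section_mult l (primitive_factor x) k = l (primitive_factor x *+ k).
  by case: k.
have [Es|[Es|Es]] : scale x = scale y \/ scale y = (scale x).+1 \/ scale x = (scale y).+1 by lia.
- have Exy : y = x by rewrite Dx Dy Es.
  have : (1 < l x)%N by rewrite -(count_mem_mset x l); apply/gt1E; exists a, b; rewrite lt_ab lb.
  by have := gap_l _ t_prim (scale x); rewrite secE // -Dx; lia.
- have := gap_l _ t_prim (scale x); rewrite -Es !secE // -Dx -Dy.
  by rewrite !in_mset in x_l y_l; move/(leq_trans (leq_add x_l y_l)).
- have := gap_l _ t_prim (scale y); rewrite -Es !secE // -Dx -Dy.
  by rewrite !in_mset in x_l y_l; move/(leq_trans (leq_add y_l x_l)).
Qed.

End GapCondition.

(** * Residues modulo 5 *)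

Definition eq_sign (a z : 'Z_5) : bool := (z == a) || (z == - a).

(** For [u] nonzero the condition says that [k] is [a / u] up to sign. This quotient is 1 up to sign
    if [u] is [a] up to sign, and 2 if [u] is [b], since 4 = -1. The proof reduces [k] modulo 5 and
    checks all cases. *)
Lemma eq_signMn (a b u : 'Z_5) k :
    (a = 1 /\ b = 2%:R) \/ (a = 2%:R /\ b = 1) ->
  eq_sign a (u *+ k) = if eq_sign a u then rr_part 0 k
     else if eq_sign b u then rr_part 1 k else false.
Proof.
have -> : u *+ k = u *+ (k %% 5).
  have u5 : u *+ 5 = 0.
    by rewrite -mulr_natr (_ : 5%:R = 0) ?mulr0 //; apply: val_inj.
  by rewrite {1}(divn_eq k 5) mulrnDr mulnC mulrnA u5 mul0rn add0r.
rewrite /rr_part; have := ltn_pmod k (isT : (0 < 5)%N); move: (k %% 5)%N => r.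
case: u => [[|[|[|[|[|u]]]]] ltu] //; case: r => [|[|[|[|[|r]]]]] // _;
by case=> -[-> ->].
Qed.

(** The first identity if [u] is [a] up to sign, the second, which excludes the part 1, if it is
    [b]; otherwise [u = 0] and both sides admit only the zero function. *)
Lemma section_bijection (a b u : 'Z_5) m :
    (a = 1 /\ b = 2%:R) \/ (a = 2%:R /\ b = 1) ->
  [set f | partfun m f /\ forall k, f k <> 0%N -> eq_sign a (u *+ k)] #=
  [set f | partfun m f /\ [/\ u = 0 -> forall k, f k = 0%N,
     forall k, (f k + f k.+1 <= 1)%N & eq_sign b u -> f 1%N = 0%N]].
Proof.
move=> ab.
have [Ea|Ea] := boolP (eq_sign a u).
  have u0 : u <> 0 by move=> u0; move: Ea; rewrite u0; case: ab => -[-> _].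
  have Eb : eq_sign b u = false.
    by move: Ea; case: ab => -[-> ->]; rewrite /eq_sign => /orP[] /eqP ->.
  move: (rogers_ramanujan m (isT : (0 <= 1)%N)).
  rewrite (_ : [set f | _ /\ forall k, _ -> is_true (eq_sign a _)] =
    [set f | partfun m f /\ forall k, f k <> 0%N -> rr_part 0 k]).
    rewrite (_ : [set f | _ /\ [/\ _, _ & _]] = [set f | partfun m f /\ gap_fun 0 f]) //.
    by apply/seteqP; split=> f [] ? [] *; split=> //; split=> //; rewrite Eb.
  by apply/seteqP; split=> f [mf rf]; split=> // k /rf; rewrite (eq_signMn _ _ ab) Ea.
have [Eb|Eb] := boolP (eq_sign b u).
  have u0 : u <> 0 by move=> u0; move: Eb; rewrite u0; case: ab => -[_ ->].
  move: (rogers_ramanujan m (isT : (1 <= 1)%N)).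
  rewrite (_ : [set f | _ /\ forall k, _ -> is_true (eq_sign a _)] =
    [set f | partfun m f /\ forall k, f k <> 0%N -> rr_part 1 k]).
    rewrite (_ : [set f | _ /\ [/\ _, _ & _]] = [set f | partfun m f /\ gap_fun 1 f]) //.
    apply/seteqP; split=> f [mf].
      by case=> _ gf f1; split=> //; split=> // _; apply: f1.
    by case=> gf f1; split=> //; split=> // _; apply: f1.
  apply/seteqP; split=> f [mf rf]; split=> // k /rf;
  by rewrite (eq_signMn _ _ ab) (negPf Ea) Eb.
have u0 : u = 0.
  move: Ea Eb; case: ab => -[-> ->]; case: u => [[|[|[|[|[|u]]]]] ltu] // _ _;
  exact: val_inj.
rewrite (_ : [set f | _ /\ [/\ _, _ & _]] =
   [set f | partfun m f /\ forall k, f k <> 0%N -> eq_sign a (u *+ k)]) //.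
apply/seteqP; split=> f [mf].
  by case=> /(_ u0) f0 _ _; split=> // k; rewrite f0.
move=> rf; split=> //; have f0 k : f k = 0%N.
  apply/eqP/negP => /negP/eqP/rf; rewrite (eq_signMn _ _ ab) (negPf Ea) (negPf Eb) //.
by split=> [_ //|k|_]; rewrite !f0.
Qed.

Section RogersRamanujanSections.
Variables (K : fieldExtType rat).
Local Notation O := (ring_of_integers K).
Variables (rho : {rmorphism O -> 'Z_5}) (d : O) (a b : 'Z_5).
Hypothesis ab : (a = 1 /\ b = 2%:R) \/ (a = 2%:R /\ b = 1).

Lemma congruent_partsE :
  [set l | is_partition d l /\ forall x, x \in l -> eq_sign a (rho x)] =
  [set l | is_partition d l /\ forall t, primitive t ->
     forall k, section_mult l t k <> 0%N -> eq_sign a (rho t *+ k)].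
Proof.
apply/seteqP; split=> l [dl Pl]; split=> //.
  move=> t t_prim [|k] //= /eqP ltk; rewrite -raddfMn; apply: Pl.
  by rewrite -mset_neq0.
move=> x xl; have [lpos _] := dl; have [s0 t_prim Dx] := scaleE (lpos x xl).
rewrite Dx raddfMn; apply: Pl => //.
by case: (scale x) s0 Dx => //= k _ <-; apply/eqP; rewrite mset_neq0.
Qed.

(** A primitive part has scale 1, so the last condition only concerns multiplicities at [k = 1]. *)
Lemma gap_partitionsE :
  [set l | [/\ is_partition d l, forall x, x \in l -> rho (primitive_factor x) <> 0,
     scale_gap2 l & ~ exists x, [/\ x \in l, primitive x & eq_sign b (rho x)]]] =
  [set l | is_partition d l /\ forall t, primitive t ->
     [/\ rho t = 0 -> forall k, section_mult l t k = 0%N,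
         forall k, (section_mult l t k + section_mult l t k.+1 <= 1)%N &
         eq_sign b (rho t) -> section_mult l t 1 = 0%N]].
Proof.
apply/seteqP; split=> l.
  case=> dl l0 gap_l lb; have [lpos _] := dl; split=> // t t_prim.
  split; last 1 first.
  - move=> bt; rewrite /= mulr1n; apply/mset_eq0P/negP => tl.
    by apply: lb; exists t.
  - move=> t0 [|k] //=; apply/mset_eq0P/negP => /l0.
    by have [_ _ ->] := scale_primitiveMn t_prim (ltn0Sn k).
  - exact: (scale_gap2P lpos).1 gap_l t t_prim.
case=> dl Ql; have [lpos _] := dl; split=> //.
- move=> x xl rx; have [s0 t_prim Dx] := scaleE (lpos x xl).
  have [/(_ rx (scale x)) + _ _] := Ql _ t_prim.
  case: (scale x) s0 Dx => //= k _ <- /eqP.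
  by rewrite mset_eq0 xl.
- by apply/(scale_gap2P lpos) => t /Ql[].
- case=> x [xl x_prim bx]; have [_ _ /(_ bx) /=] := Ql _ x_prim.
  by rewrite mulr1n => /eqP; rewrite mset_eq0 xl.
Qed.

Lemma section_partitions_equinumerous :
  [set l | is_partition d l /\ forall x, x \in l -> eq_sign a (rho x)] #=
  [set l | [/\ is_partition d l, forall x, x \in l -> rho (primitive_factor x) <> 0,
     scale_gap2 l & ~ exists x, [/\ x \in l, primitive x & eq_sign b (rho x)]]].
Proof.
rewrite congruent_partsE gap_partitionsE.
pose P t (f : nat -> nat) := forall k, f k <> 0%N -> is_true (eq_sign a (rho t *+ k)).
pose Q t (f : nat -> nat) := [/\ rho t = 0 -> forall k, f k = 0%N,
         forall k, (f k + f k.+1 <= 1)%N & eq_sign b (rho t) -> f 1%N = 0%N].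
by apply: Cantor_Bernstein; [apply: (@glue_sections _ d P Q) | apply: (@glue_sections _ d Q P)];
  move=> t m _; have := section_bijection (rho t) m ab; rewrite card_eq_le => /andP[].
Qed.
End RogersRamanujanSections.

Theorem corollary3p13 (K : fieldExtType rat) (Kreal : totally_real K)
    (p : prime_idealr (ring_of_integers K))
    (p5 : 5%:R \in p)
    (pZ5 : exists f : {rmorphism {ideal_quot p} -> 'Z_5}, bijective f)
    (d : ring_of_integers K) (d_pos : Oplus d) :
  ([set l | is_partition d l /\
      forall x, x \in l -> x = 1 %[ mod_ideal p ] \/ x = 4%:R %[ mod_ideal p ]]
   #=
   [set l | [/\ is_partition d l,
      forall x, x \in l -> primitive_factor x <> 0 %[ mod_ideal p ],
      scale_gap2 l &
      ~ exists x, [/\ x \in l, primitive x &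
          x = 2%:R %[ mod_ideal p ] \/ x = 3%:R %[ mod_ideal p ]]]])
  /\
  ([set l | is_partition d l /\
      forall x, x \in l -> x = 2%:R %[ mod_ideal p ] \/ x = 3%:R %[ mod_ideal p ]]
   #=
   [set l | [/\ is_partition d l,
      forall x, x \in l -> primitive_factor x <> 0 %[ mod_ideal p ],
      scale_gap2 l &
      ~ exists x, [/\ x \in l, primitive x &
          x = 1 %[ mod_ideal p ] \/ x = 4%:R %[ mod_ideal p ]]]]).
Proof.
have [f /bij_inj f_inj] := pZ5.
pose rho : {rmorphism ring_of_integers K -> 'Z_5} := f \o \pi_({ideal_quot p}).
(* Injectivity of [f] turns congruences modulo [p] into equalities in ['Z_5]. *)
have rhoE (x y : ring_of_integers K) : (x = y %[ mod_ideal p ]) = (rho x = rho y).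
  by apply/propext; split=> [/(congr1 f)|/f_inj].
pose pm a (x : ring_of_integers K) := is_true (eq_sign a (rho x)).
pose mod14 (x : ring_of_integers K) := x = 1 %[ mod_ideal p ] \/ x = 4%:R %[ mod_ideal p ].
pose mod23 (x : ring_of_integers K) := x = 2%:R %[ mod_ideal p ] \/ x = 3%:R %[ mod_ideal p ].
pose nmod0 (x : ring_of_integers K) := x <> 0 %[ mod_ideal p ].
have E14 : mod14 = pm 1.
  apply/funext => x; rewrite /mod14 !rhoE rmorph1 rmorph_nat.
  rewrite (_ : 4%:R = - 1); last exact: val_inj.
  by apply/propext; rewrite /pm /eq_sign; split=> [[]->|/orP[]/eqP->]; rewrite ?eqxx ?orbT; auto.
have E23 : mod23 = pm 2%:R.
  apply/funext => x; rewrite /mod23 !rhoE !rmorph_nat.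
  rewrite (_ : 3%:R = - 2%:R); last exact: val_inj.
  by apply/propext; rewrite /pm /eq_sign; split=> [[]->|/orP[]/eqP->]; rewrite ?eqxx ?orbT; auto.
have E0 : nmod0 = (fun x => rho x <> 0).
  by apply/funext => x; rewrite /nmod0 rhoE rmorph0.
(* Abstracting both sets over their predicates lets the predicates be rewritten although they occur
   under binders. *)
pose S1 A := [set l | is_partition d l /\ forall x, x \in l -> A x].
pose S2 N A := [set l | [/\ is_partition d l, forall x, x \in l -> N (primitive_factor x),
  scale_gap2 l & ~ exists x, [/\ x \in l, primitive x & A x]]].
suff: S1 mod14 #= S2 nmod0 mod23 /\ S1 mod23 #= S2 nmod0 mod14 by [].
by rewrite E14 E23 E0; split; apply: section_partitions_equinumerous; [left|right].
Qed.
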